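(* Let $a<b$ be real numbers, let $\alpha>0$ be a non-integer real number, and let $n\in\mathbb N$ be such that $\alpha\in(n-1,n)$. Let $m\in\mathbb N\cup\{0\}$, let $N\in\mathbb N$ with $N\ge m+1$, and let $x:[a,b]\to\mathbb R$ be a function of class $C^{n+m+1}$. Define $$A_k=\frac{1}{\Gamma(n+k+1-\alpha)}\left[1+\sum_{p=m-k+1}^N\frac{\Gamma(p+\alpha-n-m)}{\Gamma(\alpha-n-k)\,(p-m+k)!}\right],\qquad k\in\{0,1,\ldots,m\},$$ $$B_k=\frac{\Gamma(k+\alpha-n-m)}{\Gamma(n-\alpha)\,\Gamma(\alpha+1-n)\,(k-m-1)!},\qquad k\in\{m+1,m+2,\ldots,N\},$$ $$V_k(t)=\int_a^t(\tau-a)^k x^{(n)}(\tau)\,d\tau,\qquad k\in\{0,1,\ldots,N-m-1\},\ t\in[a,b].$$ Then, for every $t\in(a,b]$, $${}^C_aD_t^\alpha x(t)=\sum_{k=0}^{m}A_k(t-a)^{n+k-\alpha}x^{(n+k)}(t)+\sum_{k=m+1}^N B_k(t-a)^{n+m-k-\alpha}V_{k-m-1}(t)+E_N(t),$$ where the error term $E_N(t)$ satisfies $$|E_N(t)|\le \max_{\tau\in[a,t]}\left|x^{(n+m+1)}(\tau)\right|\,(t-a)^{n+m+1-\alpha}\,\frac{\exp\left((n+m-\alpha)^2+n+m-\alpha\right)}{\Gamma(n+m+1-\alpha)\,N^{n+m-\alpha}\,(n+m-\alpha)}.$$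
   Context: Here $\mathbb N=\{1,2,3,\ldots\}$, $\Gamma$ is Euler's Gamma function (extended to negative non-integer real arguments in the usual way), and $x^{(j)}$ is the $j$-th derivative of $x$. For $\alpha\in(n-1,n)$, the left Caputo fractional derivative of order $\alpha$ of $x$ is $${}^C_aD_t^\alpha x(t)=\frac{1}{\Gamma(n-\alpha)}\int_a^t(t-\tau)^{n-\alpha-1}x^{(n)}(\tau)\,d\tau.$$ *)

(* Defs.v *)
From HB Require Import structures.
From mathcomp Require Import all_boot all_order all_algebra.
From mathcomp Require Import all_classical all_reals all_analysis.

Set Implicit Arguments.
Unset Strict Implicit.
Unset Printing Implicit Defensive.

Import Order.TTheory GRing.Theory Num.Theory.
Import numFieldNormedType.Exports.

Local Open Scope classical_set_scope.
Local Open Scope ring_scope.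

Section Derivatives.
Context {R : realType}.
Implicit Types (A : set R) (f : R -> R).

(* A function on the interval A is represented by a total function whose
   values outside A are irrelevant: difference quotients at a point of A only
   use points of A, so derivatives at endpoints are one-sided. *)
Definition diff_quot f (u v : R) : R := (f v - f u) / (v - u).

Definition derivable_in A f (u : R) : Prop :=
  cvg (diff_quot f u @ within A u^').

Definition deriv_in A f : R -> R :=
  fun u => lim (diff_quot f u @ within A u^').

Definition derivn_in A (k : nat) f : R -> R := iter k (deriv_in A) f.

Definition class_C A (k : nat) f : Prop :=
  (forall i : nat, (i < k)%N ->
     forall u, A u -> derivable_in A (derivn_in A i f) u) /\
  {within A, continuous (derivn_in A k f)}.

End Derivatives.

Section Gamma.
Context {R : realType}.

Definition Gamma_pos (z : R) : R :=
  \int[lebesgue_measure]_(s in `]0, +oo[) (s `^ (z - 1) * expR (- s)).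

(* truncn (1 - z) is the least natural number j with z + j > 0 (so j = 0 when
   z > 0), and Gamma (z + j) = z (z + 1) ... (z + j - 1) Gamma z.  At the poles
   z = 0, -1, -2, ... the denominator vanishes and the value is 0. *)
Definition Gamma (z : R) : R :=
  let j := Num.truncn (1 - z) in
  Gamma_pos (z + j%:R) / \prod_(i < j) (z + i%:R).

End Gamma.

(* The largest element of S (0 if there is none). *)
Definition max_set {R : realType} (S : set R) : R :=
  xget 0 [set M | S M /\ ubound S M].

Section Caputo.
Context {R : realType}.
Implicit Types (a b alpha t : R) (n m N k : nat) (x : R -> R).

(* Left Caputo derivative of order alpha, n - 1 < alpha < n, of a function x on
   [a, b].  The integrand may be singular at tau = t, where powR gives 0; this
   is a null set for the Lebesgue integral. *)
Definition caputo a b alpha n x t : R :=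
  (Gamma (n%:R - alpha))^-1 *
  \int[lebesgue_measure]_(tau in `[a, t])
    ((t - tau) `^ (n%:R - alpha - 1) * derivn_in `[a, b] n x tau).

(* For k <= m and p >= m - k + 1, the natural number p + k - m is p - m + k. *)
Definition A_coef alpha n m N k : R :=
  (Gamma (n%:R + k%:R + 1 - alpha))^-1 *
  (1 + \sum_((m - k).+1 <= p < N.+1)
         Gamma (p%:R + alpha - n%:R - m%:R) /
         (Gamma (alpha - n%:R - k%:R) * ((p + k - m)`!)%:R)).

Definition B_coef alpha n m k : R :=
  Gamma (k%:R + alpha - n%:R - m%:R) /
  (Gamma (n%:R - alpha) * Gamma (alpha + 1 - n%:R) * ((k - m - 1)`!)%:R).

Definition V_moment a b n x k t : R :=
  \int[lebesgue_measure]_(tau in `[a, t])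
    ((tau - a) ^+ k * derivn_in `[a, b] n x tau).

End Caputo.

(* Main.v *)
Require Import Defs.
From mathcomp Require Import all_boot all_order all_algebra.
From mathcomp Require Import all_classical all_reals all_analysis.
From mathcomp Require Import measurable_realfun.
From mathcomp Require Import ring lra zify.

Set Implicit Arguments.
Unset Strict Implicit.
Unset Printing Implicit Defensive.

Import Order.TTheory GRing.Theory Num.Theory.
Import numFieldNormedType.Exports.

Local Open Scope classical_set_scope.
Local Open Scope ring_scope.

(** Write beta = n - alpha in (0, 1), T = t - a, s = m + beta and
    y_k = x^(n + k).  The Caputo derivative is the integral of
    (t - tau)^(beta - 1) y_0(tau) over [a, t], divided by Gamma(beta).

    Split the kernel into its Taylor polynomial at a of degree
    L = N - m - 1 and the remainder R(beta - 1, L), where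
      R(sigma, M)(tau) = (t - tau)^sigma
                       - sum_(p <= M) c(sigma, p) T^(sigma - p) (tau - a)^p
    and c(sigma, p) is the coefficient of u^p in (1 - u)^sigma.  Integrated
    against y_0, the polynomial yields the moments V_p, with the B_k as
    coefficients (B_coefE).

    The derivative of R(sigma, M + 1) is - sigma R(sigma - 1, M).  Integrating
    the remainder part by parts m + 1 times thus raises the exponent and the
    degree by one at each step (expansion_step, expansion).  R vanishes at a;
    its value at t is - T^sigma times the sum of the coefficients
    c(sigma, p), p <= M, and this sum is the bracket in A_k (A_coefE).  What
    remains is
      E_N(t) = 1 / Gamma(s + 1) * integral of R(s, N) y_(m + 1) over [a, t].

    For the estimate no series is needed.  Lower remainders keep a constant
    sign, so |R(s, N)| is nondecreasing on [a, t] and bounded by its value at t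
    (remainder_le_end), which by telescoping is T^s |c(s - 1, N)|
    = T^s (N + 1) / s |c(s, N + 1)|.  Bernoulli's inequality shows that
    |c(s, p)| p^(s + 1) is nonincreasing for p >= m + 1, and it is at most
    exp(s^2 + s) at p = m + 1 (onem_pow_coef_decay).

    The analytic care goes into the singularities: the first remainder blows up
    at t, so the fundamental theorem and integration by parts are proved for
    integrands that are only integrable (Rintegral_FTC_integrable,
    Rintegration_by_parts_integrable).  The same tools give the functional
    equation of Gamma (Gamma_posS, GammaS), which turns quotients of Gamma values
    into the coefficients c(sigma, p) (onem_pow_coef_Gamma). *)

(** * Integrands with singularities at the endpoints *)

Section Calculus.
Context {R : realType}.
Notation mu := (@lebesgue_measure R).
Implicit Types (f F g G : R -> R) (a b : R).

(** The integrand may be unbounded at both endpoints, as are the kernel of the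
    Caputo derivative at tau = t and the Gamma integrand at 0.  The difference
    of F and the indefinite integral of f has zero derivative inside and is
    continuous up to the endpoints (the latter by integrability of f), so the
    mean value theorem makes it constant. *)
Lemma Rintegral_FTC_integrable f F a b : a < b ->
  {within `[a, b], continuous F} ->
  (forall x, x \in `]a, b[ -> is_derive x 1 F (f x)) ->
  {in `]a, b[, continuous f} ->
  mu.-integrable `[a, b] (EFin \o f) ->
  \int[mu]_(x in `[a, b]) f x = F b - F a.
Proof.
move=> ab cF dF cf intf.
pose G x := parameterized_integral mu a x f.
have cG : {within `[a, b], continuous G}.
  by apply: parameterized_integral_continuous => //; exact: ltW.
have dG x : x \in `]a, b[ -> is_derive x 1 G (f x).
  move=> /[dup] xab; rewrite in_itv/= => /andP[ax xb].
  have [dGx G'x] := continuous_FTC1_closed xb intf ax (cf _ xab).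
  by apply: DeriveDef; [exact: dGx|rewrite -derive1E; exact: G'x].
have dFG x : x \in `]a, b[ -> is_derive x 1 (F \- G) ((fun=> 0) x).
  move=> xab; have dFx := dF _ xab; have dGx := dG _ xab.
  by rewrite -(subrr (f x)); exact: is_deriveB.
have cFG : {within `[a, b], continuous (F \- G)}.
  exact: within_continuousB.
have [c _] := MVT ab dFG cFG.
rewrite mul0r /= => /eqP; rewrite subr_eq0 => /eqP E.
have Ga : G a = 0 by rewrite /G /parameterized_integral set_itv1 Rintegral_set1.
move: E; rewrite Ga subr0 => <-.
by rewrite opprB addrC addrNK.
Qed.

Lemma itvoo_bigcup a b : `]a, b[%classic =
  \bigcup_n `[a + n.+1%:R^-1, b - n.+1%:R^-1]%classic.
Proof.
apply/seteqP; split => [x|x [n _]] /=.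
  rewrite in_itv/= => /andP[/ltr_add_invr[k ak] /ltr_add_invr[l lb]].
  have inv n p : (n.+1 + p)%:R^-1 <= n.+1%:R^-1 :> R.
    by rewrite lef_pV2 ?posrE ?ltr0n// ler_nat leq_addr.
  exists (k + l)%N => //=; rewrite in_itv/=.
  have := inv k l; have := inv l k; rewrite !addSn (addnC l k).
  set u := (k + l).+1%:R^-1; set v := l.+1%:R^-1 in lb *; set w := k.+1%:R^-1 in ak *.
  by move=> h1 h2; apply/andP; split; lra.
rewrite !in_itv/= => /andP[h1 h2].
have : 0 < n.+1%:R^-1 :> R by rewrite invr_gt0 ltr0n.
by set u := n.+1%:R^-1 in h1 h2 * => u0; apply/andP; split; lra.
Qed.

(** Integrability for free: on the segments exhausting ]a, b[ the integral of f
    is an increment of F, hence at most F b - F a since F is nondecreasing;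
    monotone convergence passes this bound to the whole interval. *)
Lemma integrable_ge0_primitive f F a b : a < b ->
  {within `[a, b], continuous F} ->
  (forall x, x \in `]a, b[ -> is_derive x 1 F (f x)) ->
  {in `]a, b[, continuous f} ->
  (forall x, x \in `]a, b[ -> 0 <= f x) ->
  mu.-integrable `[a, b] (EFin \o f).
Proof.
move=> ab cF dF cf f0.
have mf : measurable_fun `]a, b[ f.
  by apply: open_continuous_measurable_fun => // x /set_mem; exact: cf.
have mfcc : measurable_fun `[a, b] f.
  exact/measurable_fun_itv_obnd_cbndP/measurable_fun_itv_bndo_bndcP.
have F_nd u v : a <= u -> u <= v -> v <= b -> F u <= F v.
  move=> au; rewrite le_eqVlt => /predU1P[->//|uv] vb.
  have dFuv x : x \in `]u, v[ -> is_derive x 1 F (f x).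
    by rewrite in_itv/= => /andP[ux xv]; apply: dF; rewrite in_itv/= (le_lt_trans au ux) (lt_le_trans xv vb).
  have cFuv : {within `[u, v], continuous F}.
    by apply: continuous_subspaceW cF; apply: subset_itvScc; rewrite bnd_simp.
  have [c cuv E] := MVT uv dFuv cFuv.
  rewrite -subr_ge0 E mulr_ge0 ?subr_ge0 ?(ltW uv)//; apply: f0.
  by move: cuv; rewrite !in_itv/= => /andP[uc cv]; apply/andP; split; lra.
apply/integrableP; split; first exact/measurable_EFinP.
have mnf : measurable_fun `]a, b[ (fun x => `|(f x)%:E|%E).
  by apply: measurableT_comp => //; exact/measurable_EFinP.
rewrite (integral_itv_bndoo _ _ mnf).
pose A n := `[a + n.+1%:R^-1, b - n.+1%:R^-1]%classic : set R.
have subA n : A n `<=` `]a, b[ by rewrite itvoo_bigcup; exact: bigcup_sup.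
have ndA m n : (m <= n)%N -> A m `<=` A n.
  move=> mn; have inv : n.+1%:R^-1 <= m.+1%:R^-1 :> R.
    by rewrite lef_pV2 ?posrE ?ltr0n// ler_nat.
  by apply: subset_itv; rewrite bnd_simp ?lerD2l ?lerN2.
pose g n x := (`|(f \_ (A n)) x|%:E)%E.
have gE n x : A n x -> g n x = `|(f x)%:E|%E.
  by move=> Ax; rewrite /g patchE mem_set.
have gE0 n x : ~ A n x -> g n x = 0%E.
  by move=> Ax; rewrite /g patchE memNset// normr0.
have limg x : x \in `]a, b[%classic -> `|(f x)%:E|%E = limn (g ^~ x).
  rewrite inE itvoo_bigcup => -[n _ An]; apply/esym/cvg_lim => //.
  apply: cvg_near_cst; near=> k; apply: gE; apply: ndA An.
  by near: k; exists n.
rewrite (_ : integral _ _ _ = (\int[mu]_(x in `]a, b[) limn (g ^~ x))%E); last first.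
  by apply: eq_integral => x /limg.
have mA n : measurable (A n) by exact: measurable_itv.
have mg n : measurable_fun `]a, b[ (g n).
  apply/measurable_EFinP; apply: measurableT_comp => //.
  apply: (measurable_restrict f (mA n) _).1 => //.
  by apply: (measurable_funS _ (@subIsetl _ _ _) mf).
have g0 n x : `]a, b[%classic x -> (0 <= g n x)%E by move=> _; rewrite lee_fin.
have ndg x : `]a, b[%classic x -> nondecreasing_seq (g ^~ x).
  move=> _ m n mn; have [Am|Am] := pselect (A m x).
    by rewrite (gE _ _ Am) (gE n)//; exact: ndA mn _ Am.
  by rewrite (gE0 _ _ Am) lee_fin.
rewrite monotone_convergence//.
apply: (@le_lt_trans _ _ (F b - F a)%:E); last by rewrite ltry.
apply: lime_le.
  apply: ereal_nondecreasing_is_cvgn => m n mn.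
  by apply: ge0_le_integral; [|exact: g0|exact: mg|exact: mg|move=> x abx; exact: (ndg x abx m n mn)].
near=> n.
have an : a <= a + n.+1%:R^-1 by rewrite lerDl.
have bn : b - n.+1%:R^-1 <= b by rewrite gerDl oppr_le0.
have gEn : (\int[mu]_(x in `]a, b[) g n x = \int[mu]_(x in A n) (f x)%:E)%E.
  rewrite -(setIidr (subA n)) integral_mkcondr; apply: eq_integral => x.
  rewrite inE => xab; rewrite patchE; case: ifPn => [/set_mem xA|].
    by rewrite gE//= ger0_norm ?f0.
  by move=> /negP xA; rewrite gE0// => xA'; apply: xA; rewrite inE.
(* for small n the truncated interval may be a point or empty *)
rewrite gEn /A.
have [abn|abn] := ltP (a + n.+1%:R^-1) (b - n.+1%:R^-1); last first.
  have [E|E0] := eqVneq (a + n.+1%:R^-1) (b - n.+1%:R^-1).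
    by rewrite E set_itv1 integral_set1 lee_fin subr_ge0 F_nd ?(ltW ab).
  rewrite set_itv_ge ?integral_set0 ?lee_fin ?subr_ge0 ?F_nd ?(ltW ab)//.
  by rewrite bnd_simp -ltNge lt_neqAle eq_sym E0 abn.
have sub : `[a + n.+1%:R^-1, b - n.+1%:R^-1] `<=` `]a, b[ := subA n.
have dFn x : x \in `](a + n.+1%:R^-1), (b - n.+1%:R^-1)[ -> is_derive x 1 F (f x).
  by move=> /subset_itv_oo_cc/sub; exact: dF.
have cFn : {within `[a + n.+1%:R^-1, b - n.+1%:R^-1], continuous F}.
  by apply: continuous_subspaceW cF; apply: (subset_trans sub); exact: subset_itv_oo_cc.
have cfn : {in `](a + n.+1%:R^-1), (b - n.+1%:R^-1)[, continuous f}.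
  by move=> x /subset_itv_oo_cc/sub; exact: cf.
have intn : mu.-integrable `[a + n.+1%:R^-1, b - n.+1%:R^-1] (EFin \o f).
  apply: continuous_compact_integrable; first exact: segment_compact.
  by apply: continuous_in_subspaceT => x /set_mem/sub; exact: cf.
have := Rintegral_FTC_integrable abn cFn dFn cfn intn.
rewrite /Rintegral => /(congr1 (@EFin R)); rewrite fineK ?integrable_fin_num// => ->.
rewrite lee_fin; apply: lerB; apply: F_nd => //.
- exact: le_trans an (ltW abn).
- exact: le_trans (ltW abn) bn.
Unshelve. all: by end_near. Qed.

End Calculus.

Section Powers.
Context {R : realType}.
Notation mu := (@lebesgue_measure R).
Implicit Types (f F g G : R -> R) (a b t : R).

Lemma within_continuousM f g (A : set R) :
  {within A, continuous f} -> {within A, continuous g} ->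
  {within A, continuous (f \* g)}.
Proof. by move=> cf cg x; apply: continuousM; [exact: cf|exact: cg]. Qed.

Lemma continuous_segment_bounded g a b :
  {within `[a, b], continuous g} -> [bounded g x | x in `[a, b]].
Proof.
move=> cg; have /compact_bounded[M [Mr H]] := continuous_compact cg (@segment_compact _ a b).
by exists M; split => // y My x abx; apply: H My _ _; exists x.
Qed.

Lemma continuous_segment_measurable g a b :
  {within `[a, b], continuous g} -> measurable_fun `[a, b] g.
Proof. by move=> cg; exact: subspace_continuous_measurable_fun. Qed.

Lemma continuous_segment_integrable g a b :
  {within `[a, b], continuous g} -> mu.-integrable `[a, b] (EFin \o g).
Proof.
by move=> cg; apply: continuous_compact_integrable => //; exact: segment_compact.
Qed.

Lemma integrable_continuousM f g a b :
  mu.-integrable `[a, b] (EFin \o f) -> {within `[a, b], continuous g} ->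
  mu.-integrable `[a, b] (EFin \o (f \* g)).
Proof.
move=> intf cg; have := integrableMl _ intf (continuous_segment_measurable cg) (continuous_segment_bounded cg).
by apply.
Qed.

(** Integration by parts in which only the derivative of G has to be continuous
    up to the endpoints; that of F is merely integrable.  This is what the first
    step of the expansion needs, where it is a remainder of a negative power of
    t - tau. *)
Lemma Rintegration_by_parts_integrable F G f g a b : a < b ->
  {within `[a, b], continuous F} ->
  (forall x, x \in `]a, b[ -> is_derive x 1 F (f x)) ->
  {in `]a, b[, continuous f} ->
  mu.-integrable `[a, b] (EFin \o f) ->
  {within `[a, b], continuous G} ->
  (forall x, x \in `]a, b[ -> is_derive x 1 G (g x)) ->
  {within `[a, b], continuous g} ->
  \int[mu]_(x in `[a, b]) (F x * g x) =
  F b * G b - F a * G a - \int[mu]_(x in `[a, b]) (f x * G x).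
Proof.
move=> ab cF dF cf intf cG dG cg.
have intfG := integrable_continuousM intf cG.
have intFg := continuous_segment_integrable (within_continuousM cF cg).
have intg : mu.-integrable `[a, b] (EFin \o (fun x => F x * g x + f x * G x)).
  by have := integrableD _ intFg intfG; apply.
have dFG x : x \in `]a, b[ -> is_derive x 1 (F \* G) (F x * g x + f x * G x).
  move=> xab; have dFx := dF _ xab; have dGx := dG _ xab.
  by rewrite (mulrC (f x)); exact: is_deriveM.
have cFGfg : {in `]a, b[, continuous (fun x => F x * g x + f x * G x)}.
  move=> x xab; apply: cvgD; apply: cvgM.
  - exact: within_continuous_continuous ab cF xab.
  - exact: within_continuous_continuous ab cg xab.
  - exact: cf.
  - exact: within_continuous_continuous ab cG xab.
have := Rintegral_FTC_integrable ab (within_continuousM cF cG) dFG cFGfg intg.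
rewrite RintegralD// => <-.
by rewrite addrK.
Qed.

Lemma is_derive_powR_subl t p x : x < t ->
  is_derive x 1 (fun u => (t - u) `^ p) (- (p * (t - x) `^ (p - 1))).
Proof.
rewrite -subr_gt0 => tx0.
have h1 := is_derive1_powR p tx0.
have h2 : is_derive x 1 (fun u => t - u) (-1).
  by rewrite -[X in is_derive _ _ _ X]sub0r; exact: is_deriveB.
by have := @is_derive1_comp _ _ (fun u => t - u) _ _ _ h1 h2; rewrite mulrN1.
Qed.

Lemma continuous_powR_gt0 p x : 0 < x -> {for x, continuous (@powR R ^~ p)}.
Proof.
move=> x0; apply: differentiable_continuous; apply/derivable1_diffP.
by apply: derivable_powR; rewrite in_itv/= x0.
Qed.

Lemma continuous_powR_subl_lt t p x : x < t ->
  {for x, continuous (fun u => (t - u) `^ p)}.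
Proof.
move=> xt; apply: differentiable_continuous; apply/derivable1_diffP.
by have [] := is_derive_powR_subl p xt.
Qed.

Lemma within_continuous_powR_subl a t p : a < t -> 0 < p ->
  {within `[a, t], continuous (fun u => (t - u) `^ p)}.
Proof.
move=> aat p0; apply/continuous_within_itvP => //; split.
- by move=> x; rewrite in_itv/= => /andP[_ xt]; exact: continuous_powR_subl_lt.
- by apply: cvg_at_right_filter; exact: continuous_powR_subl_lt.
rewrite subrr powR0 ?gt_eqF//.
(* no continuity at 0 is available: powR is constantly 1 on negative numbers *)
apply/cvgrPdist_lt => e e0.
have /cvgrPdist_lt/(_ _ e0) := @powR_cvg0 R p p0.
rewrite near_withinE nbhs_left0P => H.
by near do rewrite opprB addrCA subrr addr0.
Unshelve. all: by end_near. Qed.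

Lemma integrable_powR_subl a t p : a < t -> 0 < p ->
  mu.-integrable `[a, t] (EFin \o (fun u => (t - u) `^ (p - 1))).
Proof.
move=> aat p0.
apply: (@integrable_ge0_primitive _ (fun u => (t - u) `^ (p - 1)) (fun u => - p^-1 * (t - u) `^ p)) => //.
- apply: within_continuousM; last exact: within_continuous_powR_subl.
  by move=> x; exact: cst_continuous.
- move=> x; rewrite in_itv/= => /andP[_ xt].
  have := is_derive_powR_subl p xt => /(is_deriveZ (- p^-1)).
  rewrite /GRing.scale/= mulrNN mulKf ?gt_eqF//.
- by move=> x; rewrite in_itv/= => /andP[_ xt]; exact: continuous_powR_subl_lt.
- by move=> x _; exact: powR_ge0.
Qed.

Lemma within_continuous_powR c p : 0 < c -> 0 < p ->
  {within `[0, c], continuous (@powR R ^~ p)}.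
Proof.
move=> c0 p0; apply/continuous_within_itvP => //; split.
- by move=> x; rewrite in_itv/= => /andP[x0 _]; exact: continuous_powR_gt0.
- by rewrite powR0 ?gt_eqF//; exact: powR_cvg0.
- by apply: cvg_at_left_filter; exact: continuous_powR_gt0.
Qed.

Lemma integrable_powR c p : 0 < c -> 0 < p ->
  mu.-integrable `[0, c] (EFin \o (fun u => u `^ (p - 1))).
Proof.
move=> c0 p0.
apply: (@integrable_ge0_primitive _ (fun u => u `^ (p - 1)) (fun u => p^-1 * u `^ p)) => //.
- apply: within_continuousM; last exact: within_continuous_powR.
  by move=> x; exact: cst_continuous.
- move=> x; rewrite in_itv/= => /andP[x0 _].
  have := is_derive1_powR p x0 => /(is_deriveZ p^-1).
  by rewrite /GRing.scale/= mulKf ?gt_eqF//.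
- by move=> x; rewrite in_itv/= => /andP[x0 _]; exact: continuous_powR_gt0.
- by move=> x _; exact: powR_ge0.
Qed.

End Powers.

(** * The Gamma function *)

Section GammaIntegral.
Context {R : realType}.
Notation mu := (@lebesgue_measure R).
Implicit Types (p z s : R).

(** The degree n.+3 term of the exponential series alone beats s `^ (p + 2). *)
Lemma powR_expRN_le p :
  exists2 C : R, 0 <= C & forall s, 1 <= s -> s `^ p * expR (- s) <= C * s `^ (- 2).
Proof.
pose n := Num.truncn `|p|.
exists ((n.+3)`!%:R) => // s s1.
have s0 : 0 < s by rewrite (lt_le_trans _ s1).
have pn : p <= n.+1%:R by rewrite (le_trans (ler_norm _))// ltW// truncnS_gt.
rewrite expRN powRN -ler_pdivrMr ?invr_gt0 ?powR_gt0// invrK mulrAC.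
rewrite ler_pdivrMr ?expR_gt0//.
have -> : s `^ 2 = s ^+ 2 by rewrite -powR_mulrn ?ltW.
apply: (@le_trans _ _ (s ^+ n.+1 * s ^+ 2)).
  rewrite ler_wpM2r ?exprn_ge0 ?(ltW s0)// -powR_mulrn ?(ltW s0)//.
  exact: ler_powR.
rewrite -exprD addn2 -ler_pdivrMl ?ltr0n ?fact_gt0// mulrC.
by apply: le_trans (expR_ge1Dxn n.+2 (ltW s0)); rewrite lerDr.
Qed.

Lemma powR_expRN_cvg0 p : s `^ p * expR (- s) @[s --> +oo] --> 0.
Proof.
have [C C0 HC] := powR_expRN_le p.
apply/cvgrPdist_lt => e e0; near=> s.
have s1 : 1 <= s by near: s; apply: nbhs_pinfty_ge; rewrite num_real.
have s0 : 0 < s by rewrite (lt_le_trans _ s1).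
rewrite sub0r normrN ger0_norm ?mulr_ge0 ?powR_ge0 ?expR_ge0//.
apply: le_lt_trans (HC _ s1) _.
have : C / e < s by near: s; apply: nbhs_pinfty_gt; rewrite num_real.
rewrite ltr_pdivrMr// => Ces.
rewrite powRN ltr_pdivrMr ?powR_gt0//.
apply: (lt_le_trans Ces).
by rewrite mulrC ler_pM2l// le1r_powR// ler1n.
Unshelve. all: by end_near. Qed.

Lemma integral_powRN2_lty : (\int[mu]_(s in `[1%R, +oo[) (s `^ (- 2))%:E < +oo)%E.
Proof.
have d1 s : 0 < s -> is_derive s 1 (fun u => - u `^ (- 1)) (s `^ (- 2)).
  move=> s0; have /is_deriveN := is_derive1_powR (- 1) s0.
  by rewrite mulN1r opprK -opprD.
rewrite (@ge0_continuous_FTC2y _ (fun s => s `^ (- 2)) (fun u => - u `^ (- 1)) 1 0).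
- by rewrite -EFinB ltry.
- by move=> s _; exact: powR_ge0.
- apply/continuous_within_itvcyP; split.
    by move=> s; rewrite in_itv/= andbT => s1; apply: continuous_powR_gt0; exact: lt_trans s1.
  by apply: cvg_at_right_filter; exact: continuous_powR_gt0.
- rewrite -[X in _ --> X]oppr0; apply: cvgN.
  apply/cvgrPdist_lt => e e0; near=> s.
  have s0 : 0 < s by near: s; apply: nbhs_pinfty_gt; rewrite num_real.
  rewrite sub0r normrN ger0_norm ?powR_ge0// powR_inv1 ?ltW// invf_plt ?posrE//.
  by near: s; apply: nbhs_pinfty_gt; rewrite num_real.
- by move=> s s1; have [] := d1 s (lt_trans ltr01 s1).
- apply: cvgN; apply: cvg_at_right_filter; exact: continuous_powR_gt0.
- move=> s; rewrite in_itv/= andbT => s1.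
  by rewrite derive1E; have /@derive_val := d1 s (lt_trans ltr01 s1).
Unshelve. all: by end_near. Qed.

Definition gamma_integrand z s : R := s `^ (z - 1) * expR (- s).

Lemma gamma_integrand_ge0 z s : 0 <= gamma_integrand z s.
Proof. by rewrite mulr_ge0 ?powR_ge0 ?expR_ge0. Qed.

Lemma continuous_gamma_integrand z s : 0 < s ->
  {for s, continuous (gamma_integrand z)}.
Proof.
move=> s0; apply: cvgM; first exact: continuous_powR_gt0.
by apply: continuous_comp; [exact: continuousN|exact: continuous_expR].
Qed.

Lemma measurable_gamma_integrand z : measurable_fun [set: R] (gamma_integrand z).
Proof.
apply: measurable_funM; first exact: measurable_powR.
by apply: measurableT_comp; [exact: measurable_expR|exact: oppr_measurable].
Qed.

Lemma integrable_gamma_integrand z : 0 < z ->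
  mu.-integrable `]0, +oo[ (EFin \o gamma_integrand z).
Proof.
move=> z0; have mg := measurable_gamma_integrand z.
have mgE (D : set R) : measurable_fun D (fun s => `|(gamma_integrand z s)%:E|%E).
  apply: measurableT_comp => //; apply/measurable_EFinP.
  exact: measurable_funS mg.
apply/integrableP; split; first by apply/measurable_EFinP; exact: measurable_funS mg.
rewrite (@itv_bndbnd_setU _ _ _ (BLeft 1)) ?bnd_simp//.
rewrite ge0_integral_setU//=; last first.
  apply/disj_set2P; rewrite -subset0 => s/=; rewrite !in_itv/= => -[/andP[_]].
  by rewrite ltNge => /negbTE ->.
  exact: mgE.
apply: lte_add_pinfty.
- apply: (@le_lt_trans _ _ (\int[mu]_(s in `[0%R, 1%R]) (s `^ (z - 1))%:E)%E).
    apply: (@le_trans _ _ (\int[mu]_(s in `]0%R, 1%R[) (s `^ (z - 1))%:E)%E).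
      apply: ge0_le_integral; [by []|by []|exact: mgE| |].
        by apply/measurable_EFinP; apply: measurable_funTS; exact: measurable_powR.
      move=> s /=; rewrite in_itv/= => /andP[s0 _].
      rewrite lee_fin ger0_norm ?gamma_integrand_ge0//.
      by rewrite ler_piMr ?powR_ge0// -expR0 ler_expR oppr_le0 ltW.
    apply: ge0_subset_integral => //.
    + by apply/measurable_EFinP; apply: measurable_funTS; exact: measurable_powR.
    + by move=> s _; rewrite lee_fin powR_ge0.
    + exact: subset_itv_oo_cc.
  have /integrableP[_] := integrable_powR ltr01 z0.
  by apply: le_lt_trans; apply: ge0_le_integral;
    [by []|by move=> s _; rewrite lee_fin powR_ge0
    |by apply/measurable_EFinP; apply: measurable_funTS; exact: measurable_powR
    |by apply: measurableT_comp => //; apply/measurable_EFinP; apply: measurable_funTS; exact: measurable_powR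
    |by move=> s _; rewrite lee_fin ler_norm].
- have [C C0 HC] := powR_expRN_le (z - 1).
  apply: (@le_lt_trans _ _ (\int[mu]_(s in `[1%R, +oo[) (C%:E * (s `^ (- 2))%:E))%E).
    apply: ge0_le_integral; [by []|by []|exact: mgE| |].
      apply/measurable_EFinP; apply: measurable_funM => //.
      by apply: measurable_funTS; exact: measurable_powR.
    move=> s /=; rewrite in_itv/= andbT => s1.
    by rewrite lee_fin ger0_norm ?gamma_integrand_ge0// HC.
  rewrite ge0_integralZl//; last 2 first.
    by apply/measurable_EFinP; apply: measurable_funTS; exact: measurable_powR.
    by move=> s _; rewrite lee_fin powR_ge0.
  have I0 : (0 <= \int[mu]_(s in `[1%R, +oo[) (s `^ (- 2))%:E)%E.
    by apply: integral_ge0 => s _; rewrite lee_fin powR_ge0.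
  by rewrite -ge0_fin_numE ?mule_ge0 ?lee_fin// fin_numM// ge0_fin_numE// integral_powRN2_lty.
Qed.

Lemma Gamma_posE z : Gamma_pos z = \int[mu]_(s in `]0, +oo[) gamma_integrand z s.
Proof. by []. Qed.

Lemma Gamma_pos_gt0 z : 0 < z -> 0 < Gamma_pos z.
Proof.
move=> z0; have intg := integrable_gamma_integrand z0.
have c12 : {within `[1, 2], continuous (gamma_integrand z)}.
  apply: continuous_in_subspaceT => s /set_mem/=; rewrite in_itv/= => /andP[s1 _].
  by apply: continuous_gamma_integrand; exact: lt_le_trans s1.
have [c] := EVT_min (ler1n R 2) c12.
rewrite in_itv/= => /andP[c1 c2] cmin.
have gc0 : 0 < gamma_integrand z c.
  by rewrite mulr_gt0 ?expR_gt0 ?powR_gt0// (lt_le_trans _ c1).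
apply: (lt_le_trans gc0).
have sub12 : `[1, 2] `<=` `]0 : R, +oo[.
  by move=> s /=; rewrite !in_itv/= andbT => /andP[s1 _]; exact: lt_le_trans s1.
rewrite Gamma_posE /Rintegral -lee_fin fineK; last exact: integrable_fin_num.
apply: (@le_trans _ _ (\int[mu]_(s in `[1%R, 2%R]) (gamma_integrand z s)%:E)%E); last first.
  apply: ge0_subset_integral => //.
    by apply/measurable_EFinP; apply: measurable_funTS; exact: measurable_gamma_integrand.
  by move=> s _; rewrite lee_fin gamma_integrand_ge0.
apply: (@le_trans _ _ (\int[mu]_(s in `[1%R, 2%R]) (cst (gamma_integrand z c)%:E s))%E).
  rewrite integral_cst//= lebesgue_measure_itv/= lte_fin ltr1n/= -EFinB -EFinM lee_fin.
  by rewrite ler_peMr ?(ltW gc0)//; lra.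
apply: ge0_le_integral; [by []| | | |].
- by move=> s _; rewrite lee_fin (ltW gc0).
- exact: measurable_cst.
- by apply/measurable_EFinP; apply: measurable_funTS; exact: measurable_gamma_integrand.
- by move=> s s12; rewrite lee_fin cmin.
Qed.

(** The derivative h of s `^ z * expR (- s) is the difference of z times the
    integrand of Gamma z and the integrand of Gamma (z + 1), so the claim is
    that h has integral zero.  As h changes sign only at z, its integral is
    computed on both sides of z: up to z by integrability, beyond z because
    h <= 0 there.  The boundary terms at z cancel. *)
Lemma Gamma_posS z : 0 < z -> Gamma_pos (z + 1) = z * Gamma_pos z.
Proof.
move=> z0.
pose F s := gamma_integrand (z + 1) s.
pose h s := z * gamma_integrand z s - gamma_integrand (z + 1) s.
have z10 : 0 < z + 1 by rewrite addr_gt0.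
have intz := integrable_gamma_integrand z0.
have intz1 := integrable_gamma_integrand z10.
have intzz : mu.-integrable `]0, +oo[ (EFin \o (fun s => z * gamma_integrand z s)).
  by have := integrableZl _ z intz; apply.
have inth : mu.-integrable `]0, +oo[ (EFin \o h).
  by have := integrableB _ intzz intz1; apply.
have dF s : 0 < s -> is_derive s 1 F (h s).
  move=> s0; have d1 := is_derive1_powR z s0.
  have d2 : is_derive s 1 (fun u => expR (- u)) (- expR (- s)).
    have dN : is_derive s 1 (fun u : R => - u) (- 1) by exact: is_deriveN.
    by have := @is_derive1_comp _ _ (fun u : R => - u) _ _ _ (is_derive_expR (- s)) dN; rewrite mulrN1.
  have := is_deriveM d1 d2; rewrite /F /h /gamma_integrand addrK /GRing.scale/=.
  by rewrite mulrN addrC [X in _ -> is_derive _ _ _ (X - _)]mulrA (mulrC (expR _)).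
have ch s : 0 < s -> {for s, continuous h}.
  move=> s0; apply: cvgB; last exact: continuous_gamma_integrand.
  by apply: cvgM; [exact: cst_continuous|exact: continuous_gamma_integrand].
have cF s : 0 < s -> {for s, continuous F} by exact: continuous_gamma_integrand.
have F0 : F 0 = 0 by rewrite /F /gamma_integrand addrK powR0 ?gt_eqF// mul0r.
have intlow : \int[mu]_(s in `[0, z]) h s = F z - F 0.
  apply: Rintegral_FTC_integrable => //.
  - apply/continuous_within_itvP => //; split.
    + by move=> s; rewrite in_itv/= => /andP[s0 _]; exact: cF.
    + rewrite F0 -[X in _ --> X](mul0r (expR (- 0))).
      apply: cvgM; first by rewrite addrK; exact: powR_cvg0.
      apply: cvg_at_right_filter; apply: continuous_comp; [exact: continuousN|exact: continuous_expR].
    + by apply: cvg_at_left_filter; exact: cF.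
  - by move=> s; rewrite in_itv/= => /andP[s0 _]; exact: dF.
  - by move=> s; rewrite in_itv/= => /andP[s0 _]; exact: ch.
  - have : mu.-integrable `]0, z] (EFin \o h).
      by apply: integrableS inth => //; apply: subset_itvl.
    move=> /integrableP[mh hlt]; apply/integrableP; split.
      exact/emeasurable_fun_itv_obnd_cbndP.
    by rewrite -integral_itv_obnd_cbnd//; exact: measurableT_comp.
have inthigh : \int[mu]_(s in `[z, +oo[) h s = - F z.
  rewrite /Rintegral (@le0_continuous_FTC2y _ h F z 0) ?sub0e//.
  - move=> s zs; have s0 : 0 < s by exact: lt_le_trans zs.
    rewrite /h /gamma_integrand addrK -(mulr_powRB1 (ltW s0) z0) -mulrA -mulrBl.
    by rewrite mulr_le0_ge0 ?subr_le0 ?gamma_integrand_ge0.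
  - apply/continuous_within_itvcyP; split.
      by move=> s; rewrite in_itv/= andbT => zs; apply: ch; exact: lt_trans zs.
    by apply: cvg_at_right_filter; exact: ch.
  - exact: powR_expRN_cvg0.
  - by apply: cvg_at_right_filter; exact: cF.
  - by move=> s zs; have [] := dF s (lt_trans z0 zs).
  - move=> s; rewrite in_itv/= andbT => zs.
    by rewrite derive1E; have /@derive_val := dF s (lt_trans z0 zs).
have : \int[mu]_(s in `]0, +oo[) h s = 0.
  rewrite (@itv_bndbnd_setU _ _ _ (BRight z)) ?bnd_simp ?(ltW z0)//.
  rewrite Rintegral_setU//=; last 2 first.
  - by rewrite -itv_bndbnd_setU ?bnd_simp ?(ltW z0).
  - apply/disj_set2P; rewrite -subset0 => s/=; rewrite !in_itv/= => -[/andP[_]].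
    by rewrite leNgt => /negbTE ->.
  rewrite !Rintegral_itv_obnd_cbnd ?intlow ?inthigh ?F0 ?subr0 ?subrr//.
  - by apply: integrableS inth => //; apply: subset_itvr; rewrite bnd_simp ltW.
  - by apply: integrableS inth => //; apply: subset_itvl.
rewrite RintegralB// RintegralZl// -!Gamma_posE => /eqP.
by rewrite subr_eq0 => /eqP.
Qed.

End GammaIntegral.

Section GammaReal.
Context {R : realType}.
Implicit Types (z s : R).

Lemma Gamma_gt0E z : 0 < z -> Gamma z = Gamma_pos z.
Proof.
move=> z0; rewrite /Gamma.
have -> : Num.truncn (1 - z) = 0%N by apply/truncn0Pn; rewrite -ltNge gtrBl.
by rewrite big_ord0 addr0 divr1.
Qed.

Lemma Gamma_gt0 z : 0 < z -> 0 < Gamma z.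
Proof. by move=> z0; rewrite Gamma_gt0E// Gamma_pos_gt0. Qed.

(** For z < 0 this is how the extension was defined: passing from z to z + 1
    removes the factor z from the denominator.  It even holds at the negative
    integers, where both sides are 0. *)
Lemma GammaS z : z != 0 -> Gamma (z + 1) = z * Gamma z.
Proof.
rewrite neq_lt => /orP[z0|z0]; last first.
  by rewrite !Gamma_gt0E ?addr_gt0// Gamma_posS.
have /truncn_itv : 0 <= 1 - z by lra.
rewrite /Gamma; case: (Num.truncn (1 - z)) => [|k] /andP[kz zk]; first by lra.
have -> : Num.truncn (1 - (z + 1)) = k.
  by apply: truncn_def; move: kz zk; rewrite -!natr1; lra.
rewrite big_ord_recl/= addr0 invfM [RHS]mulrCA mulVKf ?lt_eqF//.
have -> : z + 1 + k%:R = z + k.+1%:R by rewrite -natr1; ring.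
congr (_ / _); apply: eq_bigr => i _.
by rewrite -addrA nat1r.
Qed.

Lemma Gamma_neq0 z : (forall i : nat, z + i%:R != 0) -> Gamma z != 0.
Proof.
move=> zi; rewrite /Gamma mulf_neq0// ?invr_eq0.
  rewrite gt_eqF// Gamma_pos_gt0//.
  by have := truncnS_gt (1 - z); rewrite -natr1; lra.
by apply/prodf_neq0 => i _; exact: zi.
Qed.

Lemma Gamma_addn z q : (forall i : nat, z + i%:R != 0) ->
  Gamma (z + q%:R) = \prod_(i < q) (z + i%:R) * Gamma z.
Proof.
move=> zi; elim: q => [|q IH]; first by rewrite addr0 big_ord0 mul1r.
by rewrite -natr1 addrA GammaS// IH big_ord_recr/= mulrCA mulrA.
Qed.

End GammaReal.

(** * Coefficients of the power series of (1 - u)^s *)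

Section Coefficients.
Context {R : realType}.
Implicit Types (s : R) (p M m : nat).

(** The coefficient of u ^+ p in the power series of (1 - u) `^ s, that is
    (-1)^p times the generalized binomial coefficient of s over p. *)
Definition onem_pow_coef s p : R := \prod_(i < p) ((i%:R - s) / i.+1%:R).


Lemma onem_pow_coef0 s : onem_pow_coef s 0 = 1.
Proof. by rewrite /onem_pow_coef big_ord0. Qed.

Lemma onem_pow_coefS s p : onem_pow_coef s p.+1 = onem_pow_coef s p * ((p%:R - s) / p.+1%:R).
Proof. by rewrite /onem_pow_coef big_ord_recr. Qed.

(** Differentiating (1 - u) `^ s coefficientwise. *)
Lemma onem_pow_coef_absorb s p : p.+1%:R * onem_pow_coef s p.+1 = - s * onem_pow_coef (s - 1) p.
Proof.
elim: p => [|p IH]; first by rewrite onem_pow_coefS !onem_pow_coef0; field.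
have p1 : p.+1%:R != 0 :> R by rewrite pnatr_eq0.
have p2 : p.+2%:R != 0 :> R by rewrite pnatr_eq0.
rewrite onem_pow_coefS mulrCA [p.+2%:R * _]mulrCA mulfV// mulr1.
rewrite [in RHS]onem_pow_coefS [RHS]mulrA -IH -!natr1.
by field; rewrite natr1.
Qed.

(** Dividing the power series of (1 - u) `^ s by 1 - u sums its coefficients.
    Thanks to this closed form neither A_k nor the error estimate involves an
    infinite tail. *)
Lemma sum_onem_pow_coef s M : \sum_(p < M.+1) onem_pow_coef s p = onem_pow_coef (s - 1) M.
Proof.
elim: M => [|M IH]; first by rewrite big_ord1 !onem_pow_coef0.
have M1 : M.+1%:R != 0 :> R by rewrite pnatr_eq0.
rewrite big_ord_recr/= IH [RHS]onem_pow_coefS.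
apply: (mulfI M1); rewrite mulrDr onem_pow_coef_absorb -natr1 in M1 *.
by field.
Qed.

Lemma onem_pow_coef_Gamma s p : (forall i : nat, - s + i%:R != 0) ->
  Gamma (p%:R - s) / (Gamma (- s) * p`!%:R) = onem_pow_coef s p.
Proof.
move=> si; have G0 := Gamma_neq0 si.
rewrite addrC (Gamma_addn p si) invfM mulrA mulfK// /onem_pow_coef big_split/=.
congr (_ * _); first by apply: eq_bigr => i _; rewrite addrC.
rewrite prodfV; congr (_^-1); rewrite fact_prod big_add1/= big_mkord natr_prod.
by [].
Qed.

(** Bernoulli's inequality for a real exponent is Young's inequality for the
    pair u, 1 with exponent r. *)
Lemma Bernoulli_powR r u : 1 < r -> 0 <= u -> 1 + r * (u - 1) <= u `^ r :> R.
Proof.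
move=> r1 u0; have r0 : 0 < r by lra.
have r10 : r - 1 != 0 by lra.
have q0 : 0 < r / (r - 1) by rewrite divr_gt0//; lra.
have pq : r^-1 + (r / (r - 1))^-1 = 1 by rewrite invfM invrK; field; rewrite gt_eqF.
have := conjugate_powR u0 ler01 r0 q0 pq.
rewrite powR1 mulr1 mul1r => /(ler_wpM2l (ltW r0)).
rewrite mulrDr mulrCA mulfV ?gt_eqF// mulr1 invfM invrK mulrA mulfV ?gt_eqF// mul1r.
by lra.
Qed.

Lemma onem_pow_coef_le1 s m : m%:R <= s <= m.+1%:R -> `|onem_pow_coef s m.+1| <= 1.
Proof.
elim: m s => [|m IH] s /andP[ms sm].
  by rewrite onem_pow_coefS onem_pow_coef0 mul1r divr1 sub0r normrN ger0_norm.
have m20 : 0 < m.+2%:R :> R by rewrite ltr0n.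
have s0 : 0 <= s by apply: (le_trans _ ms).
have := congr1 (@Num.norm _ R) (onem_pow_coef_absorb s m.+1).
rewrite !normrM normrN (gtr0_norm m20) (ger0_norm s0) => E.
rewrite -(ler_pM2l m20) E mulr1; apply: (le_trans _ sm).
rewrite -[leRHS]mulr1 ler_wpM2l// IH//.
by move: ms sm; rewrite -!natr1; lra.
Qed.

End Coefficients.
Section CoefficientDecay.
Context {R : realType}.
Implicit Types (s : R) (p m N : nat).

(** For p >= m + 1 >= s the ratio of consecutive coefficients is
    1 - (s + 1) / (p + 1), at most (p / (p + 1)) `^ (s + 1) by Bernoulli, so the
    left-hand side is nonincreasing in p.  At p = m + 1 it is at most
    (m + 1) `^ (s + 1), and m + 1 <= s + 1 <= expR s. *)
Lemma onem_pow_coef_decay s m p : 0 < s -> m%:R <= s <= m.+1%:R -> (m < p)%N ->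
  `|onem_pow_coef s p| * p%:R `^ (s + 1) <= expR (s ^+ 2 + s).
Proof.
move=> s0 /[dup] smm /andP[ms sm]; elim: p => // p IH.
rewrite ltnS leq_eqVlt => /predU1P[<-|mp].
  apply: (@le_trans _ _ (m.+1%:R `^ (s + 1))).
    by rewrite ler_piMl ?powR_ge0// onem_pow_coef_le1.
  rewrite (_ : s ^+ 2 + s = s * (s + 1)); last by ring.
  rewrite expRM ge0_ler_powR ?nnegrE ?expR_ge0//; first by lra.
  apply: le_trans (expR_ge1Dx s); rewrite -natr1; lra.
apply: le_trans (IH mp).
have sp : s <= p%:R by apply: (le_trans sm); rewrite ler_nat.
have p0 : 0 < p%:R :> R by apply: lt_le_trans sp.
have p1 : 0 < p.+1%:R :> R by rewrite ltr0n.
rewrite onem_pow_coefS normrM -mulrA ler_wpM2l//.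
rewrite ger0_norm ?divr_ge0 ?subr_ge0//.
have s1 : 1 < s + 1 by lra.
have pp0 : 0 <= p%:R / p.+1%:R :> R by rewrite divr_ge0.
have := Bernoulli_powR s1 pp0.
have -> : p%:R `^ (s + 1) = (p%:R / p.+1%:R) `^ (s + 1) * p.+1%:R `^ (s + 1).
  by rewrite -powRM// ?(ltW p1)// divfK ?gt_eqF.
move=> B; rewrite ler_wpM2r ?powR_ge0//; apply: le_trans B.
rewrite -natr1 in p1 *; rewrite le_eqVlt; apply/orP; left; apply/eqP.
by field; rewrite gt_eqF.
Qed.

(** By absorption the coefficient of order N for s - 1 is, up to sign,
    (N + 1) / s times the one of order N + 1 for s. *)
Lemma onem_pow_coef_pred_bound s m N : 0 < s -> m%:R <= s <= m.+1%:R ->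
  (m < N)%N -> `|onem_pow_coef (s - 1) N| <= expR (s ^+ 2 + s) / (N%:R `^ s * s).
Proof.
move=> s0 sm mN.
have N0 : 0 < N%:R :> R by rewrite ltr0n (leq_ltn_trans _ mN).
have N10 : 0 < N.+1%:R :> R by rewrite ltr0n.
have D := onem_pow_coef_decay s0 sm (leqW mN).
have := congr1 (@Num.norm _ R) (onem_pow_coef_absorb s N).
rewrite !normrM normrN (gtr0_norm N10) (gtr0_norm s0) => E.
rewrite ler_pdivlMr ?mulr_gt0 ?powR_gt0//.
rewrite mulrCA.
have -> : `|onem_pow_coef (s - 1) N| * s = N.+1%:R * `|onem_pow_coef s N.+1| by rewrite E mulrC.
apply: le_trans D.
rewrite mulrA mulrC ler_wpM2l//.
apply: (@le_trans _ _ (N.+1%:R `^ s * N.+1%:R)).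
  by rewrite ler_wpM2r// ge0_ler_powR ?nnegrE ?ler_nat// ltW.
by rewrite (@powRD _ _ s 1) ?(gt_eqF N10) ?implybT// powRr1 ?(ltW N10).
Qed.

End CoefficientDecay.

(** * Taylor remainders of a real power *)

Section Remainder.
Context {R : realType}.
Notation mu := (@lebesgue_measure R).
Variables (a t : R).
Hypothesis aat : a < t.
Implicit Types (s x : R) (p m M N : nat).

(** The Taylor polynomial of degree M at a of the function mapping x to
    (t - x) `^ s = (t - a) `^ s * (1 - (x - a) / (t - a)) `^ s. *)
Definition taylor_pow s M x : R :=
  \sum_(p < M.+1) onem_pow_coef s p * (t - a) `^ (s - p%:R) * (x - a) ^+ p.

Definition remainder s M x : R := (t - x) `^ s - taylor_pow s M x.

Let T0 : 0 < t - a. Proof. by rewrite subr_gt0. Qed.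

Lemma is_derive_taylor_pow s M x :
  is_derive x 1 (taylor_pow s M.+1) (- s * taylor_pow (s - 1) M x).
Proof.
have dX : is_derive x 1 (fun u : R => u - a) 1.
  by rewrite -[X in is_derive _ _ _ X]subr0; exact: is_deriveB.
pose h (p : 'I_M.+2) : R -> R := fun u => onem_pow_coef s p * (t - a) `^ (s - p%:R) * (u - a) ^+ p.
have dh (p : 'I_M.+2) : is_derive x 1 (h p)
    (onem_pow_coef s p * (t - a) `^ (s - p%:R) * (p%:R * (x - a) ^+ p.-1)).
  have dXp : is_derive x 1 (fun u : R => (u - a) ^+ p) (p%:R * (x - a) ^+ p.-1).
    have := is_deriveX p dX; rewrite exprfctE => dXp.
    by apply: (is_derive_eq dXp); rewrite /GRing.scale/= mulr1.
  exact: (is_deriveZ (onem_pow_coef s p * (t - a) `^ (s - p%:R)) dXp).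
have -> : taylor_pow s M.+1 = \sum_(p < M.+2) h p.
  by apply/funext => u; rewrite fct_sumE.
apply: (is_derive_eq (is_derive_sum dh)).
rewrite big_ord_recl/= mul0r mulr0 add0r /taylor_pow mulr_sumr.
apply: eq_bigr => p _; rewrite /bump/= add1n mulrA [_ * p.+1%:R]mulrC.
rewrite !mulrA onem_pow_coef_absorb -!mulrA; congr (_ * (_ * (_ `^ _ * _))).
by rewrite -natr1; ring.
Qed.

Lemma continuous_taylor_pow s M : continuous (taylor_pow s M).
Proof.
case: M => [|M] x.
  have -> : taylor_pow s 0 = cst (onem_pow_coef s 0 * (t - a) `^ (s - 0%:R)).
    by apply/funext => u; rewrite /taylor_pow big_ord1 expr0 mulr1.
  exact: cst_continuous.
apply: differentiable_continuous; apply/derivable1_diffP.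
by have [] := is_derive_taylor_pow s M x.
Qed.

Lemma taylor_pow_start s M : taylor_pow s M a = (t - a) `^ s.
Proof.
rewrite /taylor_pow big_ord_recl/= onem_pow_coef0 subr0 expr0 mulr1 mul1r.
by rewrite big1 ?addr0// => p _; rewrite subrr expr0n mulr0.
Qed.

Lemma taylor_pow_end s M : taylor_pow s M t = (t - a) `^ s * onem_pow_coef (s - 1) M.
Proof.
rewrite /taylor_pow -sum_onem_pow_coef mulr_sumr; apply: eq_bigr => p _.
rewrite -mulrA mulrC; congr (_ * _).
by rewrite -powR_mulrn ?(ltW T0)// -powRD ?subrK// (gt_eqF T0) implybT.
Qed.

Lemma remainder_start s M : remainder s M a = 0.
Proof. by rewrite /remainder taylor_pow_start subrr. Qed.

Lemma remainder_end s M : 0 < s ->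
  remainder s M t = - ((t - a) `^ s * onem_pow_coef (s - 1) M).
Proof.
by move=> s0; rewrite /remainder taylor_pow_end subrr powR0 ?gt_eqF// sub0r.
Qed.

(** Remainders differentiate into remainders, lowering the exponent and the
    degree by one; repeated integration by parts therefore stays within this
    family of functions. *)
Lemma is_derive_remainder s M x : x < t ->
  is_derive x 1 (remainder s M.+1) (- s * remainder (s - 1) M x).
Proof.
move=> xt; rewrite mulrBr !mulNr.
apply: is_deriveB; first exact: is_derive_powR_subl.
by rewrite -mulNr; exact: is_derive_taylor_pow.
Qed.

Lemma continuous_remainder s M x : x < t -> {for x, continuous (remainder s M)}.
Proof.
move=> xt; apply: cvgB; first exact: continuous_powR_subl_lt.
exact: continuous_taylor_pow.
Qed.

Lemma within_continuous_remainder s M : 0 < s ->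
  {within `[a, t], continuous (remainder s M)}.
Proof.
move=> s0; apply: within_continuousB; first exact: within_continuous_powR_subl.
by apply: continuous_subspaceT; exact: continuous_taylor_pow.
Qed.

Lemma integrable_remainder s M : 0 < s ->
  mu.-integrable `[a, t] (EFin \o remainder (s - 1) M).
Proof.
move=> s0.
have i1 := integrable_powR_subl aat s0.
have i2 : mu.-integrable `[a, t] (EFin \o taylor_pow (s - 1) M).
  apply: continuous_segment_integrable.
  by apply: continuous_subspaceT; exact: continuous_taylor_pow.
by have := integrableB _ i1 i2; apply.
Qed.

(** The mean value theorem on [x, y]; the endpoint y = t is allowed only when the
    power is continuous there. *)
Lemma remainder_MVT s M x y : a <= x -> x < y -> y < t \/ (y = t /\ 0 < s) ->
  exists2 z, x < z < y &
    remainder s M.+1 y - remainder s M.+1 x = - s * remainder (s - 1) M z * (y - x).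
Proof.
move=> ax xy yt.
have yt' : y <= t by case: yt => [/ltW//|[->]].
have d z : z \in `]x, y[ ->
    is_derive z 1 (remainder s M.+1) (- s * remainder (s - 1) M z).
  by rewrite in_itv/= => /andP[_ zy]; apply: is_derive_remainder; exact: lt_le_trans zy yt'.
have cR : {within `[x, y], continuous (remainder s M.+1)}.
  case: yt => [yt|[-> s0]].
    apply: continuous_in_subspaceT => z /set_mem/=; rewrite in_itv/= => /andP[_ zy].
    by apply: continuous_remainder; exact: le_lt_trans yt.
  have cR := @within_continuous_remainder s M.+1 s0.
  apply: continuous_subspaceW cR.
  by apply: subset_itvr; rewrite bnd_simp.
have [z] := MVT xy d cR; rewrite in_itv/= => xzy E; by exists z.
Qed.

(** All coefficients of the series beyond the order M have the same sign when
    s < M + 1.  Without the series: the derivative of the remainder is a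
    multiple of a remainder of lower degree and the remainder vanishes at a, so
    the sign propagates by induction on M from the monotone function
    (t - x) `^ s - (t - a) `^ s. *)
Lemma remainder_sign s M : s < M.+1%:R ->
  (forall x, a <= x < t -> 0 <= remainder s M x) \/
  (forall x, a <= x < t -> remainder s M x <= 0).
Proof.
elim: M s => [|M IH] s sM.
  have E x : remainder s 0 x = (t - x) `^ s - (t - a) `^ s.
    by rewrite /remainder /taylor_pow big_ord1 onem_pow_coef0 subr0 expr0 mulr1 mul1r.
  have [s0|s0] := leP 0 s; [right|left] => x /andP[ax xt]; rewrite E.
    by rewrite subr_le0 ge0_ler_powR// ?nnegrE ?subr_ge0 ?(ltW xt) ?(ltW aat)// lerB.
  have tx0 : 0 < t - x by rewrite subr_gt0.
  rewrite subr_ge0 -(opprK s) !(powRN _ (- s)) lef_pV2 ?posrE ?powR_gt0//.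
  by rewrite ge0_ler_powR// ?nnegrE ?oppr_ge0 ?(ltW s0) ?(ltW tx0) ?(ltW T0)// lerB.
have sM' : s - 1 < M.+1%:R by move: sM; rewrite -!natr1; lra.
have key x : a <= x < t -> exists2 z, a <= z < t &
    remainder s M.+1 x = - s * remainder (s - 1) M z * (x - a).
  move=> /andP[]; rewrite le_eqVlt => /predU1P[<- _|ax xt].
    by exists a; rewrite ?lexx// subrr mulr0 remainder_start.
  have [z /andP[az zx]] := @remainder_MVT s M _ _ (lexx a) ax (or_introl xt).
  rewrite remainder_start subr0 => E.
  by exists z; rewrite // (ltW az) (lt_trans zx xt).
case: (IH _ sM') => H; case: (leP 0 s) => s0.
- right => x xat; have [z zat ->] := key x xat; have := H z zat.
  by case/andP: xat => ax _ Hz; rewrite !mulNr oppr_le0 mulr_ge0 ?subr_ge0// mulr_ge0.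
- left => x xat; have [z zat ->] := key x xat; have := H z zat.
  by case/andP: xat => ax _ Hz; rewrite mulr_ge0 ?subr_ge0// mulr_ge0// oppr_ge0 ltW.
- left => x xat; have [z zat ->] := key x xat; have := H z zat.
  case/andP: xat => ax _ Hz; rewrite mulr_ge0 ?subr_ge0//.
  by rewrite mulNr -mulrN mulr_ge0 ?oppr_ge0.
- right => x xat; have [z zat ->] := key x xat; have := H z zat.
  case/andP: xat => ax _ Hz; rewrite mulr_le0_ge0 ?subr_ge0//.
  by rewrite mulr_ge0_le0 ?oppr_ge0// ltW.
Qed.

(** The derivative of the remainder has constant sign and the remainder vanishes
    at a, so its absolute value is nondecreasing. *)
Lemma remainder_le_end s M x : 0 < s < M.+2%:R -> a <= x <= t ->
  `|remainder s M.+1 x| <= `|remainder s M.+1 t|.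
Proof.
move=> /andP[s0 sM] /andP[ax].
rewrite le_eqVlt => /predU1P[->//|xt].
move: ax; rewrite le_eqVlt => /predU1P[<-|ax]; first by rewrite remainder_start normr0.
have sM' : s - 1 < M.+1%:R by move: sM; rewrite -!natr1; lra.
have [z /andP[az zx] E1] := @remainder_MVT s M _ _ (lexx a) ax (or_introl xt).
have [w /andP[xw wt] E2] := @remainder_MVT s M _ _ (ltW ax) xt (or_intror (conj erefl s0)).
have zat : a <= z < t by rewrite (ltW az) (lt_trans zx xt).
have wat : a <= w < t by rewrite (ltW (lt_trans ax xw)) wt.
move: E1 E2; rewrite remainder_start subr0.
set r1 := remainder s M.+1 x; set r2 := remainder s M.+1 t => E1 E2.
have E3 : r2 = r1 + (r2 - r1) by ring.
case: (remainder_sign sM') => H; have Hz := H z zat; have Hw := H w wat.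
- have r10 : r1 <= 0 by rewrite E1 !mulNr oppr_le0 mulr_ge0 ?subr_ge0 ?(ltW ax)// mulr_ge0 ?(ltW s0).
  have r20 : r2 - r1 <= 0 by rewrite E2 !mulNr oppr_le0 mulr_ge0 ?subr_ge0 ?(ltW xt)// mulr_ge0 ?(ltW s0).
  by rewrite !ler0_norm//; lra.
- have r10 : 0 <= r1.
    by rewrite E1 mulr_ge0 ?subr_ge0 ?(ltW ax)// mulNr -mulrN mulr_ge0 ?oppr_ge0 ?(ltW s0).
  have r20 : 0 <= r2 - r1.
    by rewrite E2 mulr_ge0 ?subr_ge0 ?(ltW xt)// mulNr -mulrN mulr_ge0 ?oppr_ge0 ?(ltW s0).
  by rewrite !ger0_norm//; lra.
Qed.

Lemma remainder_bound s m N x : 0 < s -> m%:R <= s <= m.+1%:R -> (m < N)%N ->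
  s < N%:R -> a <= x <= t ->
  `|remainder s N x| <=
    (t - a) `^ s * (expR (s ^+ 2 + s) / (N%:R `^ s * s)).
Proof.
move=> s0 sm mN sN xat.
have := onem_pow_coef_pred_bound s0 sm mN.
case: N mN sN => // N mN sN B.
have sN2 : 0 < s < N.+2%:R by rewrite s0 (lt_le_trans sN)// ler_nat.
apply: le_trans (remainder_le_end sN2 xat) _.
by rewrite remainder_end// normrN normrM ger0_norm ?powR_ge0// ler_wpM2l ?powR_ge0.
Qed.

End Remainder.

(** * One-sided derivatives *)

Section OneSidedDerivatives.
Context {R : realType}.
Implicit Types (f : R -> R) (a b t u : R) (A : set R).

Lemma derivable_inP A f u : derivable_in A f u ->
  forall e, 0 < e -> exists2 d, 0 < d & forall v, A v -> v != u -> `|u - v| < d ->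
    `|deriv_in A f u - diff_quot f u v| < e.
Proof.
move=> H e e0.
have /cvgrPdist_lt/(_ e e0) : diff_quot f u @ within A u^' --> deriv_in A f u by exact: H.
move=> [d /= d0 Hd]; exists d => // v Av vu uv.
by apply: Hd.
Qed.

Lemma is_derive_deriv_in a b f u : a < u < b -> derivable_in `[a, b] f u ->
  is_derive u 1 f (deriv_in `[a, b] f u).
Proof.
move=> /andP[au ub] /derivable_inP H.
have L : h^-1 *: (f (h *: 1 + u) - f u) @[h --> 0^'] --> deriv_in `[a, b] f u.
  apply/cvgrPdist_lt => e /H[d d0 Hd]; near=> h.
  have h0 : h != 0 by near: h; exact: nbhs_dnbhs_neq.
  have hd : `|h| < d by near: h; exact: dnbhs0_lt.
  have ha : `|h| < u - a by near: h; apply: dnbhs0_lt; rewrite subr_gt0.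
  have hb : `|h| < b - u by near: h; apply: dnbhs0_lt; rewrite subr_gt0.
  have -> : h^-1 *: (f (h *: 1 + u) - f u) = diff_quot f u (h + u).
    by rewrite /diff_quot addrK /GRing.scale/= mulr1 mulrC.
  apply: Hd.
  - move: ha hb; rewrite /= in_itv/= !ltr_norml => /andP[h1 _] /andP[_ h2].
    by apply/andP; split; lra.
  - by rewrite -subr_eq0 addrK.
  - by rewrite opprD addrCA subrr addr0 normrN.
apply: DeriveDef; first by apply/cvg_ex; exists (deriv_in `[a, b] f u).
exact: cvg_lim L.
Unshelve. all: by end_near. Qed.

(** The difference quotients are bounded by |D| + 1 near u, D being the
    derivative. *)
Lemma derivable_in_continuous A f :
  (forall u, A u -> derivable_in A f u) -> {within A, continuous f}.
Proof.
move=> dA; apply/subspace_continuousP => u Au.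
have [d d0 Hd] := derivable_inP (dA u Au) ltr01.
set D := deriv_in A f u in Hd.
have D1 : 0 < `|D| + 1 by rewrite ltr_wpDl.
apply/cvgrPdist_lt => e e0.
exists (Num.min d (e / (`|D| + 1))) => /=; first by rewrite lt_min d0 divr_gt0.
move=> v; rewrite /ball_/= lt_min => /andP[vd ve] Av.
have [->|vu] := eqVneq v u; first by rewrite subrr normr0.
have := Hd v Av vu vd; rewrite /diff_quot => Hq.
have vu0 : v - u != 0 by rewrite subr_eq0.
rewrite distrC -[f v - f u](divfK vu0) normrM -[v - u]opprB normrN.
have q1 : `|(f v - f u) / (v - u)| < `|D| + 1.
  rewrite -[X in `|X|](subKr D); apply: le_lt_trans (ler_normB _ _) _.
  by rewrite ltrD2l.
apply: (@le_lt_trans _ _ ((`|D| + 1) * `|u - v|)).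
  by rewrite ler_wpM2r// opprB ltW.
by rewrite mulrC -ltr_pdivlMr.
Qed.

(** The maximum exists by the extreme value theorem, so max_set does not take its
    default value 0. *)
Lemma le_max_set (f : R -> R) a t x : a <= t -> {within `[a, t], continuous f} ->
  a <= x <= t -> `|f x| <= max_set [set `|f tau| | tau in `[a, t]].
Proof.
move=> aat cf axt.
have cnf : {within `[a, t], continuous (fun u => `|f u|)}.
  by move=> u; apply: cvg_norm; exact: cf.
have [c cat cmax] := EVT_max aat cnf.
rewrite /max_set; case: xgetP => [M _ [_]|/(_ `|f c|)[]].
  by apply; exists x => //=; rewrite in_itv.
split; first by exists c.
by move=> _ [v vat <-]; exact: cmax.
Qed.

End OneSidedDerivatives.

(** * Repeated integration by parts *)

Section Expansion.
Context {R : realType}.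
Notation mu := (@lebesgue_measure R).
Variables (a t : R).
Hypothesis aat : a < t.
Implicit Types (s beta : R) (m M N L p : nat).
Local Notation Rem := (remainder a t).

(** One integration by parts.  The boundary term at a vanishes since the remainder
    does; the one at t is a coefficient A_k, in closed form. *)
Lemma expansion_step s M (y y' : R -> R) : 0 < s ->
  {within `[a, t], continuous y} ->
  (forall x, x \in `]a, t[ -> is_derive x 1 y (y' x)) ->
  {within `[a, t], continuous y'} ->
  (Gamma s)^-1 * \int[mu]_(x in `[a, t]) (Rem (s - 1) M x * y x) =
  (Gamma (s + 1))^-1 * onem_pow_coef (s - 1) M.+1 * (t - a) `^ s * y t +
  (Gamma (s + 1))^-1 * \int[mu]_(x in `[a, t]) (Rem s M.+1 x * y' x).
Proof.
move=> s0 cy dy cy'.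
have intR := integrable_remainder aat M s0.
have intRy := integrable_continuousM intR cy.
have intsR : mu.-integrable `[a, t] (EFin \o (fun x => - s * Rem (s - 1) M x)).
  by have := integrableZl _ (- s) intR; apply.
have dR x : x \in `]a, t[ -> is_derive x 1 (Rem s M.+1) (- s * Rem (s - 1) M x).
  by rewrite in_itv/= => /andP[_ xt]; exact: is_derive_remainder.
have csR : {in `]a, t[, continuous (fun x => - s * Rem (s - 1) M x)}.
  move=> x; rewrite in_itv/= => /andP[_ xt]; apply: cvgM; first exact: cst_continuous.
  exact: continuous_remainder.
rewrite (Rintegration_by_parts_integrable aat (within_continuous_remainder aat s0) dR csR intsR cy dy cy').
rewrite remainder_start mul0r subr0 remainder_end//.
have -> : \int[mu]_(x in `[a, t]) (- s * Rem (s - 1) M x * y x) =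
    - s * \int[mu]_(x in `[a, t]) (Rem (s - 1) M x * y x).
  by rewrite -RintegralZl//; apply: eq_Rintegral => x _; rewrite mulrA.
rewrite GammaS ?gt_eqF//.
have G0 : Gamma s != 0 by rewrite gt_eqF// Gamma_gt0.
by field; rewrite G0 gt_eqF.
Qed.

(** Each step raises the exponent and the degree of the remainder by one, so the
    k-th boundary term carries the exponent beta + k and the degree L + k + 1. *)
Lemma expansion beta m L (y : nat -> R -> R) : 0 < beta ->
  (forall k, (k <= m.+1)%N -> {within `[a, t], continuous (y k)}) ->
  (forall k x, (k <= m)%N -> x \in `]a, t[ -> is_derive x 1 (y k) (y k.+1 x)) ->
  (Gamma beta)^-1 * \int[mu]_(x in `[a, t]) (Rem (beta - 1) L x * y 0%N x) =
  \sum_(k < m.+1) (Gamma (beta + k%:R + 1))^-1 * onem_pow_coef (beta + k%:R - 1) (L + k).+1 *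
     (t - a) `^ (beta + k%:R) * y k t +
  (Gamma (beta + m%:R + 1))^-1 *
     \int[mu]_(x in `[a, t]) (Rem (beta + m%:R) (L + m).+1 x * y m.+1 x).
Proof.
move=> beta0; elim: m => [|m IH] cy dy.
  rewrite big_ord1 addr0 addn0; apply: expansion_step => //.
  - exact: cy.
  - by move=> x; exact: dy.
  - exact: cy.
rewrite (IH (fun k km => cy k (leqW km)) (fun k x km => dy k x (leqW km))).
rewrite [in RHS]big_ord_recr/= -[RHS]addrA; congr (_ + _).
have E : beta + m.+1%:R = beta + m%:R + 1 by rewrite -natr1; ring.
have s0 : 0 < beta + m%:R + 1 by rewrite !ltr_wpDr.
have := expansion_step (L + m).+1 s0 (cy _ (leqnSn _)) (fun x => dy _ x (leqnn _)) (cy _ (leqnn _)).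
by rewrite !E addnS addrK.
Qed.

(** The pointwise bound of the remainder times the maximum of |y|, integrated over
    an interval of length t - a. *)
Lemma remainder_integral_bound s m N (y : R -> R) : 0 < s ->
  m%:R <= s <= m.+1%:R -> (m < N)%N -> s < N%:R ->
  {within `[a, t], continuous y} ->
  `|\int[mu]_(x in `[a, t]) (Rem s N x * y x)| <=
    max_set [set `|y tau| | tau in `[a, t]] * (t - a) `^ (s + 1) *
    (expR (s ^+ 2 + s) / (N%:R `^ s * s)).
Proof.
move=> s0 sm mN sN cy.
set B := expR _ / _; set M := max_set _.
have T0 : 0 < t - a by rewrite subr_gt0.
have intRy := continuous_segment_integrable
  (within_continuousM (@within_continuous_remainder _ _ _ aat s N s0) cy).
apply: le_trans (le_normr_Rintegral _ intRy) _ => //.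
have -> : M * (t - a) `^ (s + 1) * B =
    \int[mu]_(x in `[a, t]) (M * (t - a) `^ s * B).
  rewrite Rintegral_cst//= lebesgue_measure_itv/= lte_fin aat/=.
  rewrite (@powRD _ _ s 1) ?(gt_eqF T0) ?implybT// powRr1 ?(ltW T0)//.
  by ring.
apply: le_Rintegral => //.
- by have := integrable_abse intRy; apply.
- by apply: continuous_segment_integrable => x; exact: cst_continuous.
move=> x; rewrite /= in_itv/= => axt.
rewrite normrM mulrC -mulrA; apply: ler_pM => //.
- exact: le_max_set (ltW aat) cy axt.
- exact: (remainder_bound aat s0 sm mN sN axt).
Qed.

End Expansion.

(** * The coefficients of the expansion *)

Section CaputoExpansion.
Context {R : realType}.
Notation mu := (@lebesgue_measure R).

Lemma natr_neq_shift (beta : R) (k i : nat) : 0 < beta < 1 ->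
  - (beta + k%:R) + i%:R != 0.
Proof.
move=> /andP[b0 b1]; rewrite addrC subr_eq0.
have [ik|ki] := leqP i k.
  have : i%:R <= k%:R :> R by rewrite ler_nat.
  by move=> ik'; rewrite lt_eqF//; lra.
have : k.+1%:R <= i%:R :> R by rewrite ler_nat.
by rewrite -natr1 => ki'; rewrite gt_eqF//; lra.
Qed.

Lemma A_coefE (alpha : R) n m N k : 0 < n%:R - alpha < 1 ->
  (k <= m)%N -> (m < N)%N ->
  A_coef alpha n m N k =
  (Gamma (n%:R - alpha + k%:R + 1))^-1 *
    onem_pow_coef (n%:R - alpha + k%:R - 1) (N - m.+1 + k).+1.
Proof.
move=> b01 km mN; rewrite /A_coef.
set s := n%:R - alpha + k%:R.
have -> : n%:R + k%:R + 1 - alpha = s + 1 by rewrite /s; ring.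
have -> : alpha - n%:R - k%:R = - s by rewrite /s; ring.
have sneg := @natr_neq_shift (n%:R - alpha) k ^~ b01; rewrite -/s in sneg.
congr (_ * _); rewrite -sum_onem_pow_coef big_ord_recl/= onem_pow_coef0.
(* shift p = q.+1 + (m - k); the leading 1 of the bracket is the term of order 0 *)
congr (_ + _); rewrite -[(m - k).+1]add1n big_addn big_add1/=.
have -> : ((N.+1 - (m - k)).-1 = (N - m.+1 + k).+1)%N by lia.
rewrite big_mkord; apply: eq_bigr => q _.
have -> : (q.+1 + (m - k) + k - m = q.+1)%N by lia.
rewrite /bump/= add1n -onem_pow_coef_Gamma//.
congr (Gamma _ / _); rewrite natrD natrB// /s; ring.
Qed.

Lemma B_coefE (alpha : R) n m p : 0 < n%:R - alpha < 1 ->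
  B_coef alpha n m (p + m.+1) =
  (Gamma (n%:R - alpha))^-1 * onem_pow_coef (n%:R - alpha - 1) p.
Proof.
move=> /andP[b0 b1]; rewrite /B_coef.
have -> : (p + m.+1 - m - 1 = p)%N by lia.
set s := n%:R - alpha - 1.
have -> : alpha + 1 - n%:R = - s by rewrite /s; ring.
have -> : (p + m.+1)%:R + alpha - n%:R - m%:R = p%:R - s.
  by rewrite natrD -natr1 /s; ring.
rewrite -onem_pow_coef_Gamma; last first.
  by move=> i; rewrite gt_eqF// ltr_wpDr// /s; lra.
by rewrite -(mulrA (Gamma (n%:R - alpha))) invfM mulrCA.
Qed.

Lemma Rintegral_taylor_pow (a t s : R) M (y : R -> R) :
  {within `[a, t], continuous y} ->
  \int[mu]_(x in `[a, t]) (taylor_pow a t s M x * y x) =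
  \sum_(p < M.+1) onem_pow_coef s p * (t - a) `^ (s - p%:R) *
    \int[mu]_(x in `[a, t]) ((x - a) ^+ p * y x).
Proof.
move=> cy.
have cX p : {within `[a, t], continuous (fun x => (x - a) ^+ p)}.
  apply: continuous_subspaceT => x.
  apply: (@continuous_comp _ _ _ (fun u : R => u - a) (fun u : R => u ^+ p)); last exact: exprn_continuous.
  by apply: cvgB => //; exact: cst_continuous.
have iX p : mu.-integrable `[a, t] (EFin \o (fun x => (x - a) ^+ p * y x)).
  by apply: continuous_segment_integrable; exact: within_continuousM (cX p) cy.
have icX k p : mu.-integrable `[a, t] (EFin \o (fun x => k * ((x - a) ^+ p * y x))).
  by have := integrableZl _ k (iX p); apply.
elim: M => [|M IH].
  rewrite big_ord1 -RintegralZl//; apply: eq_Rintegral => x _.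
  by rewrite /taylor_pow big_ord1 mulrA.
rewrite big_ord_recr/= -IH -RintegralZl// -RintegralD//.
  apply: eq_Rintegral => x _; rewrite mulrA -mulrDl; congr (_ * _).
  by rewrite /taylor_pow big_ord_recr.
apply: continuous_segment_integrable; apply: within_continuousM cy.
by apply: continuous_subspaceT; exact: continuous_taylor_pow.
Qed.

End CaputoExpansion.

Theorem theorem1 (R : realType) (a b : R) (hab : a < b)
  (alpha : R) (halpha : 0 < alpha) (halphaZ : alpha \isn't a Num.int)
  (n : nat) (hn : (0 < n)%N) (hnalpha : n%:R - 1 < alpha < n%:R)
  (m N : nat) (hN : (m + 1 <= N)%N)
  (x : R -> R) (hx : class_C `[a, b] (n + m + 1) x) :
  exists E_N : R -> R, forall t : R, a < t <= b ->
    caputo a b alpha n x t =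
      (\sum_(0 <= k < m.+1)
        A_coef alpha n m N k * (t - a) `^ (n%:R + k%:R - alpha) *
        derivn_in `[a, b] (n + k) x t)
      + (\sum_(m.+1 <= k < N.+1)
          B_coef alpha n m k * (t - a) `^ (n%:R + m%:R - k%:R - alpha) *
          V_moment a b n x (k - m - 1) t)
      + E_N t
    /\
    `|E_N t| <=
      max_set [set `|derivn_in `[a, b] (n + m + 1) x tau| | tau in `[a, t]]
      * (t - a) `^ (n%:R + m%:R + 1 - alpha)
      * (expR ((n%:R + m%:R - alpha) ^+ 2 + n%:R + m%:R - alpha)
         / (Gamma (n%:R + m%:R + 1 - alpha)
            * N%:R `^ (n%:R + m%:R - alpha) * (n%:R + m%:R - alpha))).
Proof.
pose y k := derivn_in `[a, b] (n + k) x.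
pose beta := n%:R - alpha.
have b01 : 0 < beta < 1 by rewrite /beta; apply/andP; split; lra.
have /andP[b0 b1] := b01.
have mN : (m < N)%N by rewrite -addn1.
have [dx cx] := hx.
have nm1 : (n + m.+1 = n + m + 1)%N by rewrite addnS addn1.
have cyab k : (k <= m.+1)%N -> {within `[a, b], continuous (y k)}.
  rewrite leq_eqVlt => /predU1P[->|km]; first by rewrite /y nm1.
  by apply: derivable_in_continuous; apply: dx; rewrite -nm1 ltn_add2l.
(* E_N is the integral left after m + 1 integrations by parts *)
exists (fun t => (Gamma (beta + m%:R + 1))^-1 *
  \int[lebesgue_measure]_(tau in `[a, t])
    (remainder a t (beta + m%:R) N tau * y m.+1 tau)).
move=> t /andP[aat tb].
have cy k : (k <= m.+1)%N -> {within `[a, t], continuous (y k)}.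
  move=> /cyab; apply: continuous_subspaceW.
  by apply: subset_itvl; rewrite bnd_simp.
have dy k u : (k <= m)%N -> u \in `]a, t[ -> is_derive u 1 (y k) (y k.+1 u).
  rewrite in_itv/= => km /andP[au ut]; rewrite {2}/y addnS.
  apply: is_derive_deriv_in; first by rewrite au (lt_le_trans ut tb).
  apply: dx; first by rewrite -nm1 ltn_add2l ltnS.
  by rewrite /= in_itv/= (ltW au) (le_trans (ltW ut) tb).
split; last first.
  set s := beta + m%:R.
  have s0 : 0 < s by rewrite /s ltr_wpDr.
  have sm : m%:R <= s <= m.+1%:R by rewrite /s -natr1; apply/andP; split; lra.
  have sN : s < N%:R.
    apply: (@lt_le_trans _ _ m.+1%:R); last by rewrite ler_nat.
    by rewrite /s -natr1; lra.
  have -> : n%:R + m%:R - alpha = s by rewrite /s /beta; ring.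
  have -> : n%:R + m%:R + 1 - alpha = s + 1 by rewrite /s /beta; ring.
  have -> : s ^+ 2 + n%:R + m%:R - alpha = s ^+ 2 + s by rewrite /s /beta; ring.
  have G0 : 0 < Gamma (s + 1) by rewrite Gamma_gt0// addr_gt0.
  have B := remainder_integral_bound aat s0 sm mN sN (cy _ (leqnn _)).
  rewrite normrM ger0_norm ?invr_ge0 ?(ltW G0)// -nm1 -/(y m.+1).
  move: B; rewrite -(ler_pM2l (_ : 0 < (Gamma (s + 1))^-1)) ?invr_gt0// => /le_trans; apply.
  rewrite -(mulrA (Gamma _)) [in leRHS]invfM (mulrCA (expR _)).
  by rewrite [leRHS]mulrCA.
pose L := (N - m.+1)%N.
have intR := integrable_remainder aat L b0.
have intRy := integrable_continuousM intR (cy 0%N isT).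
have intP : lebesgue_measure.-integrable `[a, t]
    (EFin \o (fun u => taylor_pow a t (beta - 1) L u * y 0%N u)).
  apply: continuous_segment_integrable; apply: within_continuousM; last exact: cy.
  by apply: continuous_subspaceT; exact: continuous_taylor_pow.
(* the Taylor part of the kernel gives the moments V_k, its remainder the A_k *)
have -> : caputo a b alpha n x t = (Gamma beta)^-1 *
    (\int[lebesgue_measure]_(u in `[a, t]) (remainder a t (beta - 1) L u * y 0%N u) +
     \int[lebesgue_measure]_(u in `[a, t]) (taylor_pow a t (beta - 1) L u * y 0%N u)).
  rewrite -RintegralD// /caputo -/beta; congr (_ * _).
  apply: eq_Rintegral => u _; rewrite -mulrDl subrK.
  by rewrite /y addn0.
rewrite mulrDr (expansion aat L b0 cy dy) addrAC; congr (_ + _ + _).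
- rewrite big_mkord; apply: eq_bigr => k _.
  rewrite (A_coefE b01) ?ltn_ord//; last by rewrite -ltnS.
  have -> // : n%:R + k%:R - alpha = beta + k%:R by rewrite /beta; ring.
- rewrite Rintegral_taylor_pow; last exact: cy.
  rewrite -[m.+1]add0n big_addn mulr_sumr.
  have -> : (N.+1 - m.+1 = L.+1)%N by rewrite subSS -(subnSK mN).
  rewrite big_mkord; apply: eq_bigr => p _.
  rewrite (B_coefE m p b01) -/beta /V_moment.
  have -> : (p + m.+1 - m - 1 = p)%N by rewrite addnS -addSn addnK subn1.
  have -> : n%:R + m%:R - (p + m.+1)%:R - alpha = beta - 1 - p%:R.
    by rewrite natrD -natr1 /beta; ring.
  by rewrite !mulrA /y addn0.
- have -> // : (L + m).+1 = N by rewrite -addnS subnK.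
Qed.
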